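(* Let $b\in\mathbb{N}$ and let $a_1,a_2\in\mathbb{N}$ be relatively prime to $b$. Suppose that $9\nmid b$. Then \[ S(a_1,b)-S(a_2,b)\in 24\mathbb{Z} \] if and only if \[ b\bigl(a_2\,\mu(b,a_1)-a_1\,\mu(b,a_2)\bigr)\equiv (a_1-a_2)(b-1)(a_1a_2+b-1)\pmod{8b}. \]
   Context: For an integer $a$ and a natural number $b$ with $\gcd(a,b)=1$, the Dedekind sum is $s(a,b)=\sum_{k=1}^{b}((k/b))((ak/b))$, where $((x))=x-\lfloor x\rfloor-1/2$ if $x\in\mathbb{R}\setminus\mathbb{Z}$ and $((x))=0$ if $x\in\mathbb{Z}$. Put $S(a,b)=12\,s(a,b)$. For coprime integers $a$ and $b\ge 1$, define \[ \mu(a,b)=\begin{cases} 2-2\left(\frac{a}{b}\right), & \text{if } b \text{ is odd},\\ 4, & \text{if } b\equiv 0 \pmod 4 \text{ and } a\equiv 3\pmod 4,\\ 0, & \text{otherwise},\end{cases} \] where $\left(\frac{a}{b}\right)$ is the Jacobi symbol. In the claim, $\mu(b,a_i)$ means $\mu$ evaluated with first argument $b$ and second argument $a_i$. *)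

(* Defs.v *)
From HB Require Import structures.
From mathcomp Require Export all_boot all_order all_algebra.

Set Implicit Arguments.
Unset Strict Implicit.
Unset Printing Implicit Defensive.

Import Order.TTheory GRing.Theory Num.Theory.
Local Open Scope ring_scope.

(* ((x)) *)
Definition sawtooth (R : archiRealFieldType) (x : R) : R :=
  if x \is a Num.int then 0 else x - (Num.floor x)%:~R - 1 / 2%:R.

(* All arguments k/b and ak/b are rational, so s(a, b) is a rational number. *)
Definition dedekind_sum (a : int) (b : nat) : rat :=
  \sum_(1 <= k < b.+1)
    sawtooth (k%:R / b%:R) * sawtooth (a%:~R * k%:R / b%:R).

Definition dedekindS (a : int) (b : nat) : rat := 12%:R * dedekind_sum a b.

(* Meaningful for p an odd prime. *)
Definition legendre (a : int) (p : nat) : int :=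
  if (p%:Z %| a)%Z then 0
  else if [exists x : 'I_p, (x%:Z ^+ 2 == a %[mod p%:Z])%Z] then 1 else -1.

(* Meaningful for n odd; the empty product gives (a/1) = 1. *)
Definition jacobi (a : int) (n : nat) : int :=
  \prod_(p <- primes n) legendre a p ^+ logn p n.

Definition mu (a : int) (b : nat) : int :=
  if odd b then 2 - 2 * jacobi a b
  else if (4 %| b)%N && (a == 3 %[mod 4])%Z then 4
  else 0.

(* Main.v *)
Require Import Defs.
From mathcomp Require Import all_fingroup all_solvable all_field.
From mathcomp Require Import zify ring.

Import Order.TTheory GRing.Theory Num.Theory.
Set Implicit Arguments.
Unset Strict Implicit.
Unset Printing Implicit Defensive.
Local Open Scope ring_scope.

(** The integer [N(a, b) = b S(a, b)] satisfies the reciprocity law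
    [a N(a, b) + b N(b, a) = a^2 + b^2 + 1 - 3ab]; it is divisible by 3 when 3
    does not divide [b], and for odd [b] it is [b + 1 - 2 (a/b)] modulo 8.  The
    last congruence is first proved with the sign of Gauss's lemma in place of
    the Jacobi symbol.  That sign is multiplicative in [a]; the congruence and
    the reciprocity law of [N] give it a quadratic reciprocity law, hence
    multiplicativity in [b], and at primes it is the Legendre symbol by Gauss's
    lemma and Euler's criterion.

    Let [D = N(a1, b) - N(a2, b)] and [X = (a1 - a2)(a1 a2 - 1)].  By
    reciprocity [b | D] iff [b | X].  When 9 does not divide [b], [b | D]
    already forces [3b | D], so only [8b | D] matters.  If [a1] and [a2] are
    odd, reciprocity and the congruence for [N(b, ai)] modulo 8 express [8b | D]
    in terms of [mu].  If one of them is even, [b] is odd, the 8-part of the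
    criterion is automatic, and [b | X] forces [(a1/b) = (a2/b)], hence
    [8 | D]. *)

(** * Reciprocity *)

Lemma mulmod_inj (a b k l : nat) : coprime a b -> (k < b)%N -> (l < b)%N ->
  (a * k = a * l %[mod b])%N -> k = l.
Proof.
move=> cab; wlog le_kl : k l / (k <= l)%N => [wl kb lb e|kb lb /eqP].
  by case/orP: (leq_total k l) => le; [|symmetry]; apply: wl.
rewrite eq_sym (eqn_mod_dvd _ _) ?leq_mul2l ?le_kl ?orbT// -mulnBr Gauss_dvdr
  1?coprime_sym//.
move=> /dvdn_leq d; apply/eqP; rewrite eqn_leq le_kl leqNgt/=.
by apply/negP => lt_xy; move: d; lia.
Qed.

Lemma reindex_mulmod (V : nmodType) (a b : nat) (f : nat -> V) :
  coprime a b -> \sum_(k < b) f ((a * k) %% b)%N = \sum_(k < b) f k.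
Proof.
case: b => [|b] cab; first by rewrite !big_ord0.
pose h (k : 'I_b.+1) : 'I_b.+1 := Ordinal (ltn_pmod (a * k) (ltn0Sn b)).
rewrite [RHS](reindex_inj (h := h)) //= => x y [] e.
exact/val_inj/(mulmod_inj cab (ltn_ord x) (ltn_ord y)).
Qed.

(** The non-polynomial part of [dedekindN]. Reciprocity relates it for [(a, b)] and [(b, a)]; modulo
    8 only its parity matters. *)
Definition quo_sum (a b : nat) : nat := \sum_(k < b) (k * ((a * k) %/ b)).

(* [b * S(a, b)] for coprime [a] and [b], see [dedekindS_dedekindN]. *)
Definition dedekindN (a b : nat) : int :=
  2 * a%:Z * (b%:Z - 1) * (2 * b%:Z - 1) - 12 * (quo_sum a b)%:Z
  - 3 * b%:Z * (b%:Z - 1).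

Lemma sum_id (b : nat) : (2 * \sum_(k < b) k)%N%:Z = b%:Z * (b%:Z - 1).
Proof.
elim: b => [|b IH]; first by rewrite big_ord0.
rewrite big_ord_recr /=; move: (\sum_(k < b) _)%N IH => s IH.
by rewrite mulnDr PoszD IH; lia.
Qed.

Lemma sum_sqr (b : nat) :
  (6 * \sum_(k < b) k ^ 2)%N%:Z = b%:Z * (b%:Z - 1) * (2 * b%:Z - 1).
Proof.
elim: b => [|b IH]; first by rewrite big_ord0.
rewrite big_ord_recr /=; move: (\sum_(k < b) _)%N IH => s IH.
by rewrite mulnDr PoszD IH; lia.
Qed.

(** Sum the divisions [a * k = q * b + r] over [k < b]: the remainders [r] permute the [k]. *)
Lemma sum_quo (a b : nat) : (0 < b)%N -> coprime a b ->
  (2 * \sum_(k < b) (a * k) %/ b)%N%:Z = (a%:Z - 1) * (b%:Z - 1).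
Proof.
move=> b0 cab; have e1 := reindex_mulmod id cab.
have e2 : (a * \sum_(k < b) k = (\sum_(k < b) (a * k) %/ b) * b +
  \sum_(k < b) k)%N.
  rewrite -[X in (_ + X)%N]e1 big_distrr big_distrl /= -big_split /=.
  by apply: eq_bigr => k _; rewrite -divn_eq.
have := sum_id b; set s := (\sum_(k < b) k)%N in e2 *.
set q := (\sum_(k < b) _)%N in e2 * => es.
apply: (mulfI (_ : b%:Z != 0)); first by lia.
move: e2 => /(congr1 Posz); rewrite !PoszM !PoszD !PoszM => e2.
have -> : b%:Z * (2 * q%:Z) = 2 * (a%:Z * s%:Z - s%:Z) by rewrite e2; ring.
have -> : 2 * (a%:Z * s%:Z - s%:Z) = (a%:Z - 1) * (2 * s%:Z) by ring.
by rewrite -PoszM es; ring.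
Qed.

(** Expand [r ^ 2 = (a * k - b * q) ^ 2] and sum over [k < b]: the [r] permute the [k], and the
    cross term is [quo_sum a b]. *)
Lemma sum_quo_sqr (a b : nat) : (0 < b)%N -> coprime a b ->
  6 * b%:Z * (\sum_(k < b) ((a * k) %/ b) ^ 2)%N%:Z =
  12 * a%:Z * (quo_sum a b)%:Z - (a%:Z ^+ 2 - 1) * (b%:Z - 1) * (2 * b%:Z - 1).
Proof.
move=> b0 cab; have e1 := reindex_mulmod (fun k => k ^ 2)%N cab.
have e2 : (\sum_(k < b) k ^ 2 + 2 * a * b * quo_sum a b =
  a ^ 2 * (\sum_(k < b) k ^ 2) + b ^ 2 * \sum_(k < b) ((a * k) %/ b) ^ 2)%N.
  rewrite -[X in (X + _)%N]e1 !big_distrr -!big_split /=.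
  apply: eq_bigr => k _; have := divn_eq (a * k) b.
  move: (_ %/ _)%N (_ %% _)%N => q r e.
  have -> : (a ^ 2 * k ^ 2 = (a * k) * (a * k))%N by ring.
  have -> : (2 * a * b * (k * q) = 2 * b * q * (a * k))%N by ring.
  by rewrite e; ring.
have := sum_sqr b; set s := (\sum_(k < b) _)%N in e2 *.
set q := (\sum_(k < b) _)%N in e2 * => es.
apply: (mulfI (_ : b%:Z != 0)); first by lia.
move: e2 => /(congr1 Posz); move: es.
rewrite !PoszM !PoszD !PoszM => es e2.
have -> : b%:Z * (6 * b%:Z * q%:Z) = 6 * (b%:Z * b%:Z * q%:Z) by ring.
have -> : b%:Z * b%:Z * q%:Z = s%:Z + 2 * a%:Z * b%:Z * (quo_sum a b)%:Z - a%:Z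
  * a%:Z * s%:Z by rewrite e2; ring.
transitivity (12 * a%:Z * b%:Z * (quo_sum a b)%:Z - (a%:Z ^+ 2 - 1) * (6 *
  s%:Z)); first by ring.
by rewrite es; ring.
Qed.

Lemma sum_leq_triangle (a m : nat) : (m < a)%N ->
  (2 * \sum_(j < a | j <= m) j = m * m.+1)%N.
Proof.
move=> ma; rewrite -(big_mkord (fun j => j <= m)%N id) /=.
rewrite (big_cat_nat (n := m.+1)) //= [X in (_ + X)%N]big_nat_cond.
rewrite [X in (_ + X)%N]big1 ?addn0; last by move=> i /=; lia.
rewrite big_nat_cond (eq_bigl (fun i => (0 <= i < m.+1)%N)); last first.
  by move=> i; lia.
rewrite -big_nat big_mkord.
have := sum_id m.+1; lia.
Qed.

(* Both sides count, with weight [j], the lattice points [(k, j)] with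
   [0 < k < b], [0 < j < a] and [j * b <= a * k]. *)
Lemma sum_quo_triangle (a b : nat) : (0 < a)%N -> (0 < b)%N -> coprime a b ->
  (\sum_(k < b) ((a * k) %/ b) * ((a * k) %/ b).+1)%N%:Z =
  a%:Z * (a%:Z - 1) * (b%:Z - 1) - 2 * (quo_sum b a)%:Z.
Proof.
move=> a0 b0 cab.
have e1 : (\sum_(k < b) ((a * k) %/ b) * ((a * k) %/ b).+1 =
   2 * \sum_(k < b) \sum_(j < a | j * b <= a * k) j)%N.
  rewrite big_distrr /=; apply: eq_bigr => k _.
  rewrite -(@sum_leq_triangle a) ?ltn_divLR // ?ltn_pmul2l//.
  by congr (2 * _)%N; apply: eq_bigl => j; rewrite leq_divRL.
rewrite e1.
(* For fixed [j > 0], the admissible [k] are those above [b * j %/ a], since [a * k = j * b] would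
   give [a %| j]. Their number and [b * j %/ a] add up to [b.-1]. *)
have e2 : (\sum_(k < b) \sum_(j < a | j * b <= a * k) j + quo_sum b a =
   \sum_(j < a) j * b.-1)%N.
  rewrite (exchange_big_dep predT) //= /quo_sum -big_split /=.
  apply: eq_bigr => j _; rewrite sum_nat_const -mulnC -mulnDr.
  have [->|j0] := posnP j; first by rewrite !mul0n.
  congr (_ * _)%N.
  have lt1 : (b * j %/ a < b)%N by rewrite ltn_divLR // ltn_pmul2l.
  rewrite -sum1_card -(big_mkord (fun k => j * b <= a * k)%N (fun=> 1%N)) /=.
  rewrite (big_cat_nat (n := (b * j %/ a).+1)) //=.
  rewrite [X in (X + _ + _)%N]big_nat_cond big1 ?add0n; last first.
    move=> k; rewrite ltnS leq_divRL// => /andP[/andP[_ lek] gek].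
    have : (a * k = j * b)%N by lia.
    move=> e; have : (a %| j * b)%N by rewrite -e dvdn_mulr.
    by rewrite Gauss_dvdl// => /dvdn_leq; have := ltn_ord j; lia.
  rewrite big_nat_cond (eq_bigl (fun i => ((b * j %/ a).+1 <= i < b)%N)).
    by rewrite -big_nat sum_nat_const_nat muln1; lia.
  move=> k /=; case: (ltnP (b * j %/ a) k) => //=; rewrite ltn_divLR//; lia.
move: e2; rewrite -big_distrl /= => e2.
have := sum_id a; move: (\sum_(k < a) k)%N e2 => s e2.
move: (\sum_(k < b) _)%N (quo_sum b a) e2 => u v e2.
have -> : b%:Z - 1 = b.-1 by lia.
rewrite PoszM => <-.
have -> : 2 * s%:Z * b.-1%:Z - 2 * v%:Z = 2 * ((s * b.-1)%N%:Z - v%:Z) by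
  rewrite PoszM; ring.
by rewrite -e2; lia.
Qed.

(** The lattice point count expresses the sum of [q ^ 2 + q] through [quo_sum b a]. The sum of [q]
    has a closed form and that of [q ^ 2] involves [quo_sum a b], so eliminating both links the two
    [quo_sum]. *)
Lemma dedekindN_reciprocity (a b : nat) :
  (0 < a)%N -> (0 < b)%N -> coprime a b ->
  a%:Z * dedekindN a b + b%:Z * dedekindN b a =
  a%:Z ^+ 2 + b%:Z ^+ 2 + 1 - 3 * a%:Z * b%:Z.
Proof.
move=> a0 b0 cab; have := sum_quo_triangle a0 b0 cab.
have -> : (\sum_(k < b) ((a * k) %/ b) * ((a * k) %/ b).+1 =
  \sum_(k < b) ((a * k) %/ b) ^ 2 + \sum_(k < b) (a * k) %/ b)%N.
  by rewrite -big_split /=; apply: eq_bigr => k _; ring.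
have := sum_quo_sqr b0 cab; have := sum_quo b0 cab.
rewrite PoszD /dedekindN PoszM.
move: (\sum_(k < b) _)%N (\sum_(k < b) _)%N (quo_sum a b) (quo_sum b a) => v u
  q q' e1 e2 e3.
have e4 : 12 * a%:Z * q%:Z = 6 * b%:Z * v%:Z + (a%:Z ^+ 2 - 1) * (b%:Z - 1) *
  (2 * b%:Z - 1) by rewrite e2; ring.
have e5 : v%:Z = a%:Z * (a%:Z - 1) * (b%:Z - 1) - 2 * q'%:Z - u%:Z by rewrite
  -e3; ring.
transitivity (a%:Z * (2 * a%:Z * (b%:Z - 1) * (2 * b%:Z - 1) - 3 * b%:Z * (b%:Z
  - 1)) - 12 * a%:Z * q%:Z
  + b%:Z * (2 * b%:Z * (a%:Z - 1) * (2 * a%:Z - 1) - 12 * q'%:Z - 3 * a%:Z *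
    (a%:Z - 1))); first by ring.
rewrite e4 e5.
transitivity (a%:Z * (2 * a%:Z * (b%:Z - 1) * (2 * b%:Z - 1) - 3 * b%:Z * (b%:Z
  - 1)) - 6 * b%:Z * a%:Z * (a%:Z - 1) * (b%:Z - 1) + 3 * b%:Z * (2 * u%:Z)
  - (a%:Z ^+ 2 - 1) * (b%:Z - 1) * (2 * b%:Z - 1)
  + b%:Z * (2 * b%:Z * (a%:Z - 1) * (2 * a%:Z - 1) - 3 * a%:Z * (a%:Z - 1)));
    first by ring.
by rewrite e1; ring.
Qed.

(** * Dedekind sums *)

Lemma sawtooth_natdiv (b m : nat) : (0 < b)%N -> ~~ (b %| m)%N ->
  sawtooth (m%:R / b%:R : rat) = (m %% b)%N%:R / b%:R - 1 / 2%:R.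
Proof.
move=> b0 nbm; have b0' : (b%:R : rat) != 0 by rewrite pnatr_eq0 -lt0n.
have bgt0 : (0 : rat) < b%:R by rewrite ltr0n.
have fE : Num.floor (m%:R / b%:R : rat) = (m %/ b)%N.
  apply: Num.Theory.floor_def; rewrite -PoszD addn1 -!pmulrn.
  rewrite ler_pdivlMr// ltr_pdivrMr// -!natrM ler_nat ltr_nat.
  by rewrite leq_trunc_div ltn_ceil.
have eE : (m%:R / b%:R : rat) = (m %/ b)%N%:R + (m %% b)%N%:R / b%:R.
  by rewrite {1}(divn_eq m b) natrD natrM mulrDl mulfK.
have ne : ((m %/ b)%N%:R == (m %/ b)%N%:R + (m %% b)%N%:R / b%:R :> rat) =
  false.
  rewrite -[X in X == _]addr0 (inj_eq (addrI _)) eq_sym.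
  by rewrite mulf_eq0 invr_eq0 (negPf b0') orbF pnatr_eq0 -/(dvdn b m) (negPf
    nbm).
by rewrite /sawtooth intrEfloor fE -pmulrn eE ne; congr (_ - _); ring.
Qed.

Lemma dedekindS_dedekindN (a b : nat) : (0 < b)%N -> coprime a b ->
  b%:R * dedekindS a%:Z b = (dedekindN a b)%:~R.
Proof.
move=> b0 cab; have b0' : (b%:R : rat) != 0 by rewrite pnatr_eq0 -lt0n.
(* [g] ignores the integer case of the sawtooth. The term [k = b] of the Dedekind sum is 0, but
   [g 0 = 1 / 4], hence the subtracted [1 / 4]. *)
pose g k : rat := (k%:R / b%:R - 1 / 2) * (((a * k) %% b)%N%:R / b%:R - 1 / 2).
have -> : dedekindS a b = 12 * (\sum_(k < b) g k - 1 / 4).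
  rewrite /dedekindS /dedekind_sum big_nat_recr //= divff //.
  have -> : sawtooth (1 : rat) = 0 by rewrite /sawtooth rpred1.
  rewrite mul0r addr0 -(big_mkord predT g) [X in _ = _ * (X - _)]big_ltn //.
  have -> : g 0%N = 1 / 4 by rewrite /g muln0 mod0n mul0r; field.
  rewrite [1 / 4 + _]addrC addrK; congr (_ * _); apply: eq_big_nat => k
    /andP[k0 kb].
  have nbk : ~~ (b %| k)%N by rewrite gtnNdvd.
  rewrite -pmulrn -natrM !sawtooth_natdiv// ?(modn_small kb)//.
  by rewrite Gauss_dvdr // coprime_sym.
have e1 : (\sum_(k < b) (k * ((a * k) %% b)) + b * quo_sum a b = a * \sum_(k <
  b) k ^ 2)%N.
  rewrite /quo_sum !big_distrr -big_split /=; apply: eq_bigr => k _.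
  rewrite mulnCA -mulnDr addnC [(b * _)%N]mulnC -divn_eq; ring.
have {e1} e1 : (\sum_(k < b) (k * ((a * k) %% b)))%N%:R =
  a%:R * (\sum_(k < b) k ^ 2)%N%:R - b%:R * (quo_sum a b)%:R :> rat.
  by rewrite -natrM -e1 natrD natrM addrK.
have -> : \sum_(k < b) g k = (\sum_(k < b) (k * ((a * k) %% b)))%N%:R / b%:R ^+
  2
   - (\sum_(k < b) k)%N%:R / b%:R + b%:R / 4.
  (* Half of the sum is rewritten over the residues [a * k %% b], so that both sides agree term by
     term. *)
  have -> : (\sum_(k < b) k)%N%:R = (\sum_(k < b) k%:R + \sum_(k < b) ((a * k)
    %% b)%N%:R) / 2 :> rat.
    by rewrite (reindex_mulmod (fun k => k%:R : rat) cab) natr_sum; field.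
  have -> : b%:R / 4 = \sum_(k < b) (1 / 4 : rat) by rewrite sumr_const
    card_ord -mulr_natr; field.
  rewrite natr_sum -!mulrA -big_split /= !mulr_suml -sumrB -big_split /=.
  apply: eq_bigr => k _; rewrite /g natrM; by field.
rewrite e1.
have := sum_id b => /(congr1 (fun z : int => z%:~R : rat)).
have := sum_sqr b => /(congr1 (fun z : int => z%:~R : rat)).
rewrite !(intrM, intrB) -!pmulrn !natrM => es ei.
have -> : (\sum_(k < b) k)%N%:R = b%:R * (b%:R - 1) / 2 :> rat by rewrite -ei;
  field.
have -> : (\sum_(k < b) k ^ 2)%N%:R = b%:R * (b%:R - 1) * (2 * b%:R - 1) / 6 :>
  rat by rewrite -es; field.
by rewrite /dedekindN; field.
Qed.

(** Modulo 3 only the first term of [dedekindN] survives, and [b - 1] or [2 * b - 1] is a multiple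
    of 3. *)
Lemma dedekindN_mod3 (a b : nat) : ~~ (3 %| b)%N -> (3 %| dedekindN a b)%Z.
Proof.
move=> n3; suff : (3 %| (b%:Z - 1) * (2 * b%:Z - 1))%Z.
  case/dvdzP => t et; apply/dvdzP; exists (2 * a%:Z * t - 4 * (quo_sum a b)%:Z
    - b%:Z * (b%:Z - 1)).
  by rewrite /dedekindN -!mulrA et; ring.
have [e|e] : (b %% 3 = 1 \/ b %% 3 = 2)%N by lia.
  by apply: dvdz_mulr; lia.
by apply: dvdz_mull; lia.
Qed.

(** * The sign of Gauss's lemma *)

(* For odd [b], [a * k = (-1) ^ gauss_neg a b k * gauss_res a b k] modulo [b],
   with [gauss_res a b k] in the half system [1, ..., b./2]. *)
Definition gauss_neg (a b k : nat) : bool := (b./2 < (a * k) %% b)%N.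

Definition gauss_res (a b k : nat) : nat :=
  if gauss_neg a b k then (b - (a * k) %% b)%N else ((a * k) %% b)%N.

Definition gauss_sign (a b : nat) : int :=
  \prod_(i < b./2) (-1) ^+ gauss_neg a b i.+1.

Lemma mulmod_gt0 (a b k : nat) : coprime a b -> (0 < k < b)%N ->
  (0 < (a * k) %% b)%N.
Proof.
move=> cab /andP[k0 kb]; rewrite lt0n -/(dvdn _ _) Gauss_dvdr 1?coprime_sym//.
by rewrite gtnNdvd.
Qed.

(** [gauss_res a b] permutes the half system: equal values mean that [a * k] and [a * l] are equal
    or opposite modulo [b]. The opposite case would give [b %| k + l], but [0 < k + l < b]. *)
Lemma reindex_gauss_res (R : comPzRingType) (a b : nat) (f : nat -> R) :
  odd b -> coprime a b ->
  \prod_(i < b./2) f (gauss_res a b i.+1) = \prod_(i < b./2) f i.+1.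
Proof.
move=> ob cab.
have res_itv (i : 'I_b./2) : (0 < gauss_res a b i.+1 <= b./2)%N.
  have := @mulmod_gt0 a b i.+1 cab; have := ltn_ord i.
  have := @ltn_pmod (a * i.+1) b.
  by rewrite /gauss_res /gauss_neg; move: (_ %% _)%N => r; case: (ltnP b./2 r);
    lia.
have h_lt (i : 'I_b./2) : ((gauss_res a b i.+1).-1 < b./2)%N.
  by have := res_itv i; lia.
rewrite [RHS](reindex_inj (h := fun i => Ordinal (h_lt i))) /=.
  by apply: eq_bigr => i _; rewrite prednK//; case/andP: (res_itv i).
move=> i j [] e; apply/val_inj => /=.
have {e} : gauss_res a b i.+1 = gauss_res a b j.+1.
  by have := res_itv i; have := res_itv j; lia.
have ib := ltn_ord i; have jb := ltn_ord j.
have same : ((a * i.+1) %% b = (a * j.+1) %% b)%N -> i = j :> nat.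
  by move=> e; have := @mulmod_inj a b i.+1 j.+1 cab; lia.
have opp : ((a * i.+1) %% b + (a * j.+1) %% b = b)%N -> i = j :> nat.
  move=> e; have : (b %| a * (i.+1 + j.+1))%N.
    by rewrite mulnDr /dvdn -modnDm e modnn.
  by rewrite Gauss_dvdr 1?coprime_sym// => /dvdn_leq; lia.
have := @ltn_pmod (a * i.+1) b; have := @ltn_pmod (a * j.+1) b.
rewrite /gauss_res; case: (gauss_neg a b i.+1); case: (gauss_neg a b j.+1) =>
  l1 l2 e.
- by apply: same; lia.
- by apply: opp; lia.
- by apply: opp; lia.
- exact: same.
Qed.

(** Up to sign [c * k] is [gauss_res c b k], and a change of sign flips [gauss_neg a b]: the
    residues of [a * r] and [a * (b - r)] add up to the odd number [b], so exactly one of them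
    exceeds [b./2]. *)
Lemma gauss_negM (a c b k : nat) : odd b -> coprime a b -> coprime c b ->
  (0 < k < b)%N ->
  gauss_neg (a * c) b k = gauss_neg c b k (+) gauss_neg a b (gauss_res c b k).
Proof.
move=> ob cab ccb kb; have b0 : (0 < b)%N by case: (b) ob.
have := mulmod_gt0 ccb kb; have := ltn_pmod (c * k) b0.
rewrite /gauss_res /gauss_neg -mulnA -[((a * (c * k)) %% b)%N]modnMmr.
move: ((c * k) %% b)%N => r rb r0; case: ifP => //= _.
have u0 : (0 < (a * r) %% b)%N by apply: mulmod_gt0; rewrite ?r0.
have v0 : (0 < (a * (b - r)) %% b)%N.
  by apply: mulmod_gt0; rewrite // subn_gt0 rb ltn_subrL r0.
have : (b %| a * r + a * (b - r))%N by rewrite -mulnDr subnKC ?dvdn_mull// ltnW.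
rewrite /dvdn -modnDm -/(dvdn _ _); move: (ltn_pmod (a * r) b0) (ltn_pmod (a *
  (b - r)) b0).
move: ((a * r) %% b)%N ((a * (b - r)) %% b)%N u0 v0 => u v u0 v0 ub vb /dvdnP[q
  e].
have q1 : q = 1%N by case: q e => [|[|q]]; rewrite ?mulSn; lia.
by rewrite q1 in e; lia.
Qed.

Lemma gauss_signM (a c b : nat) : odd b -> coprime a b -> coprime c b ->
  gauss_sign (a * c) b = gauss_sign a b * gauss_sign c b.
Proof.
move=> ob cab ccb; rewrite /gauss_sign.
rewrite -(reindex_gauss_res (fun k => (-1) ^+ gauss_neg a b k) ob ccb).
rewrite -big_split /=; apply: eq_bigr => i _.
have := ltn_ord i => ib.
by rewrite gauss_negM // ?signr_addb 1?mulrC//; lia.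
Qed.

Lemma gauss_sign_modl (a c b : nat) : (a = c %[mod b])%N ->
  gauss_sign a b = gauss_sign c b.
Proof.
move=> e; apply: eq_bigr => i _.
by rewrite /gauss_neg -modnMml e modnMml.
Qed.

Lemma gauss_sign_odd (a b : nat) :
  gauss_sign a b = (-1) ^+ odd (\sum_(i < b./2) gauss_neg a b i.+1).
Proof. by rewrite signr_odd -prodrXr. Qed.

Lemma gauss_sign_pm1 (a b : nat) : gauss_sign a b = 1 \/ gauss_sign a b = -1.
Proof. by rewrite gauss_sign_odd; case: odd; [right|left]. Qed.

(** Modulo 2 the first sum keeps the odd indices and the second supplies the even ones, so together
    they cancel the third. *)
Lemma parity_sum_mul (q : nat -> nat) (h : nat) : q 0%N = 0%N ->
  odd (\sum_(k < h.*2.+1) k * q k + \sum_(i < h) q i.+1.*2 + \sum_(k < h.*2.+1)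
    q k) = false.
Proof.
move=> q0; elim: h => [|h IH].
  by rewrite !big_ord_recr !big_ord0 /= q0.
rewrite doubleS !(big_ord_recr h) !(big_ord_recr h.*2.+2) !(big_ord_recr
  h.*2.+1) /=.
move: IH; rewrite !oddD !oddM /= !odd_double doubleS /=.
do 4 case: odd => //=; by case: odd.
Qed.

(** The parity of [quo_sum a b] is that of the sum of the [q k] plus the sum of the [q k] over even
    [k]. The former has a closed form; the latter has the parity of the exponent of
    [gauss_sign a b]. *)
Lemma dedekindN_mod8 (a b : nat) : odd b -> coprime a b ->
  (8 %| dedekindN a b - b%:Z - 1 + 2 * gauss_sign a b)%Z.
Proof.
move=> ob cab; have b0 : (0 < b)%N by case: b ob {cab}.
pose q k := ((a * k) %/ b)%N; pose h := b./2.
have bE : b = h.*2.+1 by rewrite -[LHS]odd_double_half ob.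
(* Doubling [k] doubles the quotient, with a carry exactly when the remainder exceeds [b./2]. *)
have qE (i : 'I_h) : q i.+1.*2 = (2 * q i.+1 + gauss_neg a b i.+1)%N.
  rewrite /q /gauss_neg -/h; have := divn_eq (a * i.+1) b.
  have := ltn_pmod (a * i.+1) b0.
  move: (_ %/ _)%N (_ %% _)%N => u v vb e.
  have -> : (a * i.+1.*2 = 2 * u * b + 2 * v)%N by rewrite -muln2 mulnA e; ring.
  rewrite divnMDl//; congr (_ + _)%N.
  case: (ltnP h v) => l; last by rewrite divn_small//; lia.
  have -> : (2 * v = 1 * b + (2 * v - b))%N by lia.
  by rewrite divnMDl// divn_small//; lia.
have := @parity_sum_mul q h; rewrite /q muln0 div0n -/q => /(_ erefl).
rewrite -bE -/(quo_sum a b) (eq_bigr _ (fun i _ => qE i)) big_split /=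
  -big_distrr /=.
have := sum_quo b0 cab; rewrite -/q gauss_sign_odd -/h /dedekindN.
rewrite (_ : (\sum_(k < b) (a * k) %/ b)%N = \sum_(k < b) q k)%N //.
move: (\sum_(k < b) _)%N (\sum_(i < h) _)%N (\sum_(i < h) _)%N (quo_sum a b) =>
  s w nu Q es par.
have {es} es : s%:Z = (a%:Z - 1) * h%:Z by lia.
have -> : ((-1) ^+ odd nu : int) = 1 - 2 * (odd nu)%:Z by case: (odd nu).
have [t et] : exists t, Q%:Z = 2 * t - nu%:Z - s%:Z.
  by exists ((Q + (2 * w + nu) + s)./2%:Z - w%:Z); move: par; lia.
have [n en] : exists n : int, nu%:Z = 2 * n + (odd nu)%:Z by exists nu./2; lia.
have [m em] : exists m : int, h%:Z * (h%:Z - 1) = 2 * m.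
  have := odd_double_half h; move: (h./2) => x; case: odd => <-.
    by exists (x%:Z * (2 * x%:Z + 1)); lia.
  by exists (x%:Z * (2 * x%:Z - 1)); lia.
have -> : b%:Z = 2 * h%:Z + 1 by lia.
apply/dvdzP.
exists (2 * a%:Z * h%:Z ^+ 2 + 2 * a%:Z * h%:Z - 3 * t + 3 * n + (odd nu)%:Z
  - 3 * m - 4 * h%:Z).
rewrite et es {1}en; move: (odd nu)%:Z => e.
transitivity (16 * a%:Z * h%:Z ^+ 2 + 16 * a%:Z * h%:Z - 24 * t + 24 * n + 8 * e
  - 32 * h%:Z - 12 * (h%:Z * (h%:Z - 1))); first by ring.
by rewrite em; ring.
Qed.

(** Substituting both congruences modulo 8 into the reciprocity law of [dedekindN] leaves a finite
    check on the signs and on [a] and [b] modulo 4. *)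
Lemma gauss_sign_reciprocity (a b : nat) : odd a -> odd b -> coprime a b ->
  gauss_sign a b = gauss_sign b a * (-1) ^+ (odd a./2 && odd b./2).
Proof.
move=> oa ob cab.
have a0 : (0 < a)%N by case: (a) oa. have b0 : (0 < b)%N by case: (b) ob.
have := dedekindN_reciprocity a0 b0 cab.
have := dedekindN_mod8 ob cab.
rewrite coprime_sym in cab; have := dedekindN_mod8 oa cab.
case/dvdzP => u eu /dvdzP[v ev].
have -> : dedekindN a b = v * 8 + b%:Z + 1 - 2 * gauss_sign a b by rewrite -ev;
  ring.
have -> : dedekindN b a = u * 8 + a%:Z + 1 - 2 * gauss_sign b a by rewrite -eu;
  ring.
move: (gauss_sign a b) (gauss_sign b a) (gauss_sign_pm1 a b) (gauss_sign_pm1 b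
  a) {eu ev} => g g' g1 g1'.
have := odd_double_half a; rewrite oa; have := odd_double_half b; rewrite ob.
move: a./2 b./2 => x y <- <-.
have := odd_double_half x; have := odd_double_half y.
move: (x./2) (y./2) (odd x) (odd y) => x' y' ex ey <- <-.
by case: g1 => ->; case: g1' => ->; case: ex; case: ey => //=; lia.
Qed.

(** Reciprocity turns this into multiplicativity in the first argument. *)
Lemma gauss_sign_mulr (a b c : nat) : odd b -> odd c -> coprime a (b * c) ->
  gauss_sign a (b * c) = gauss_sign a b * gauss_sign a c.
Proof.
(* Reciprocity needs odd [a]; adding the odd number [b * c] changes the parity of [a] but not its
   residues modulo [b], [c] and [b * c]. *)
move=> ob oc; wlog oa : a / odd a => [wl|].
  case oa: (odd a); first exact: wl.
  move=> cabc; have := wl (a + b * c)%N; rewrite oddD oa oddM ob oc => /(_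
    erefl).
  rewrite {1}/coprime gcdnC gcdnDr gcdnC => /(_ cabc).
  have e d : (d %| b * c)%N -> gauss_sign (a + b * c) d = gauss_sign a d.
    by move=> /dvdnP[q ->]; apply: gauss_sign_modl; rewrite addnC modnMDl.
  by rewrite !e ?dvdnn ?(dvdn_mulr _ (dvdnn _)) ?(dvdn_mull _ (dvdnn _)).
move=> cabc; move: (cabc); rewrite coprimeMr => /andP[cab cac].
rewrite !(@gauss_sign_reciprocity a) ?oddM ?ob// gauss_signM 1?coprime_sym//.
rewrite mulrACA; congr (_ * _); rewrite -signr_addb; congr (_ ^+ _).
have -> : odd (b * c)./2 = odd b./2 (+) odd c./2.
  have := odd_double_half b; have := odd_double_half c; rewrite ob oc.
  move: b./2 c./2 => x y <- <-.
  have -> : ((true + x.*2) * (true + y.*2) = (x + y + (x * y).*2).*2.+1)%N by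
    lia.
  by rewrite /= uphalf_double !oddD odd_double addbF.
by case: odd => //=.
Qed.

(** * The Jacobi symbol *)

(** Multiply by the product of [1, ..., p./2], nonzero in ['F_p]; on the right it is taken over the
    permuted values [gauss_res a p k], which match the [a * k] up to sign. *)
Lemma gauss_lemma (a p : nat) : prime p -> odd p -> coprime a p ->
  (a%:R : 'F_p) ^+ p./2 = (gauss_sign a p)%:~R.
Proof.
move=> pp op cap.
have p0 := prime_gt0 pp.
pose f : nat -> 'F_p := fun k => k%:R.
have nz : \prod_(i < p./2) f i.+1 != 0.
  apply/prodf_neq0 => i _; rewrite /f -(dvdn_pcharf (pchar_Fp pp)).
  by rewrite gtnNdvd//; have := ltn_ord i; lia.
apply: (mulIf nz).
rewrite -[in RHS](reindex_gauss_res f op cap) /gauss_sign rmorph_prod /=.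
rewrite -big_split /= -[X in _ ^+ X]card_ord -prodr_const -big_split /=.
apply: eq_bigr => i _; rewrite rmorphXn rmorphN1 /f /gauss_res -natrM.
case: ifP => _; last by rewrite mul1r Fp_nat_mod.
rewrite mulN1r natrB 1?ltnW ?ltn_pmod// pchar_Fp_0// sub0r opprK Fp_nat_mod//.
Qed.

(** The unit group is cyclic of order [2 * h]: a power [g ^ i] of a generator satisfies
    [(g ^ i) ^ h = 1] iff [2 * h] divides [i * h], that is, iff [i] is even. *)
Lemma euler_criterion (F : finFieldType) (h : nat) (x : F) :
  #|F| = h.*2.+1 -> x != 0 -> reflect (exists y, x = y ^+ 2) (x ^+ h == 1).
Proof.
move=> cF x0; apply: (iffP eqP) => [xh|[y xy]]; last first.
  have y0 : y != 0 by apply: contraNneq x0 => y0; rewrite xy y0 expr0n.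
  by apply: (mulfI y0); rewrite xy -exprM mul2n -exprS -cF expf_card mulr1.
have h0 : (0 < h)%N.
  by have := finNzRing_gt1 F; rewrite cF; case: (h).
pose u : {unit F} := FinRing.unit F (etrans (unitfE x) x0).
have /cyclicP[g gT] := field_unit_group_cyclic [set: {unit F}]%G.
have ug : u \in <[g]>%g by rewrite -gT inE.
have og : #[g]%g = h.*2 by rewrite /order -gT card_finField_unit cF.
have /cycleP[i ui] := ug.
have /eqP : (u ^+ h)%g = 1%g by apply/val_inj; rewrite FinRing.val_unitX.
rewrite ui -expgM -order_dvdn og -muln2 mulnC dvdn_pmul2r// => /dvdnP[j ej].
exists (val (g ^+ j)%g); rewrite -FinRing.val_unitX -expgM -ej.
by rewrite -ui.
Qed.

Lemma legendre_gauss_sign (a p : nat) : prime p -> odd p -> coprime a p ->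
  legendre a%:Z p = gauss_sign a p.
Proof.
move=> pp op cap; have := gauss_lemma pp op cap.
have npa : ~~ (p %| a)%N by rewrite -prime_coprime// coprime_sym.
have a0 : (a%:R : 'F_p) != 0 by rewrite -(dvdn_pcharf (pchar_Fp pp)).
have cF : #|'F_p| = p./2.*2.+1 by rewrite card_Fp// -[LHS]odd_double_half op.
have N1 : (-1 : 'F_p) != 1.
  rewrite eq_sym -addr_eq0 -(natrD _ 1 1) -(dvdn_pcharf (pchar_Fp pp)).
  by rewrite gtnNdvd//; have := prime_gt1 pp; case: (p) op => [|[|[|]]].
rewrite /legendre dvdzE /= (negPf npa).
case: ifP => [/existsP[x ex]|/negbT/existsPn nx].
  have -> : (a%:R : 'F_p) ^+ p./2 = 1.
    apply/eqP/(euler_criterion cF a0); exists x%:R.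
    rewrite expr2 -natrM -[RHS]Fp_nat_mod// -[LHS]Fp_nat_mod//; congr (_%:R).
    by move: ex; rewrite expr2 -PoszM !modz_nat => /eqP[].
  by case: (gauss_sign_pm1 a p) => -> // /eqP; rewrite rmorphN1 eq_sym (negPf
    N1).
case: (gauss_sign_pm1 a p) => -> // /eqP/(euler_criterion cF a0)[y ey].
have yp : (y < p)%N by rewrite -[X in (_ < X)%N](Fp_cast pp).
have /negP[] := nx (Ordinal yp); rewrite /= expr2 -PoszM !modz_nat; apply/eqP;
  congr Posz.
by rewrite -!(val_Fp_nat pp) ey natrM natr_Zp expr2.
Qed.

Lemma jacobi_gauss_sign (a n : nat) : odd n -> coprime a n ->
  jacobi a%:Z n = gauss_sign a n.
Proof.
move=> on can; have n0 : (0 < n)%N by case: (n) on.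
have sn : all (fun p => [&& prime p, odd p & coprime a p]) (primes n).
  apply/allP => p; rewrite mem_primes => /and3P[pp _ pn].
  by rewrite pp (dvdn_odd pn on) (coprime_dvdr pn can).
rewrite [in RHS](prod_prime_decomp n0) prime_decompE big_map /= /jacobi.
(* Oddness and coprimality of the partial products are carried along, as [gauss_sign_mulr] requires
   them. *)
suff [-> _ _] : [/\ gauss_sign a (\prod_(p <- primes n) p ^ logn p n) =
    \prod_(p <- primes n) legendre a%:Z p ^+ logn p n,
    odd (\prod_(p <- primes n) p ^ logn p n) &
    coprime a (\prod_(p <- primes n) p ^ logn p n)] by [].
elim: (primes n) sn => [_|p s IH /= /andP[/and3P[pp op cap] /IH[e o c]]].
  by rewrite !big_nil coprimen1 /gauss_sign big_ord0.
rewrite !big_cons coprimeMr oddM oddX op orbT o c andbT coprimeXr//; split=> //.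
rewrite gauss_sign_mulr ?oddX ?op ?orbT ?coprimeMr ?c ?coprimeXr//.
congr (_ * _) => //; rewrite legendre_gauss_sign//.
elim: (logn p n) => [|k IHk]; first by rewrite /gauss_sign big_ord0.
rewrite expnS gauss_sign_mulr ?oddX ?op ?orbT ?coprimeMr ?cap ?coprimeXr//.
by rewrite IHk exprS.
Qed.

Lemma gauss_sign1 (b : nat) : gauss_sign 1 b = 1.
Proof.
apply: big1 => i _; have := ltn_ord i => ib.
by rewrite /gauss_neg mul1n modn_small; [rewrite ltnNge ib | lia].
Qed.

(** Each prime [p] dividing [b] divides one of the factors, so modulo [p] either [x] equals [y] or
    the two are inverse; their Legendre symbols agree in both cases. *)
Lemma jacobi_eq_dvdz (x y b : nat) : odd b -> coprime x b -> coprime y b ->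
  (b%:Z %| (x%:Z - y%:Z) * (x%:Z * y%:Z - 1))%Z ->
  jacobi x%:Z b = jacobi y%:Z b.
Proof.
move=> ob cxb cyb bX; apply: eq_big_seq => p.
rewrite mem_primes => /and3P[pp _ pb]; congr (_ ^+ _).
have op := dvdn_odd pb ob.
have cxp := coprime_dvdr pb cxb; have cyp := coprime_dvdr pb cyb.
rewrite !legendre_gauss_sign//.
have : (p%:Z %| x%:Z - y%:Z)%Z || (p%:Z %| x%:Z * y%:Z - 1)%Z.
  have := dvdz_trans (pb : (p%:Z %| b%:Z)%Z) bX.
  by rewrite !dvdzE abszM Euclid_dvdM.
rewrite -!eqz_mod_dvd => /orP[].
  by rewrite !modz_nat => /eqP[e]; apply: gauss_sign_modl.
rewrite -PoszM !modz_nat => /eqP[e].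
have := gauss_signM op cxp cyp; rewrite (gauss_sign_modl e) gauss_sign1.
by case: (gauss_sign_pm1 x p) => ->; case: (gauss_sign_pm1 y p) => ->.
Qed.

(** * The criterion *)

Lemma mu_eq0_or4 (b a : nat) : coprime b a -> mu b%:Z a = 0 \/ mu b%:Z a = 4.
Proof.
move=> cba; rewrite /mu; case: ifP => [oa|_]; last by case: ifP; [right|left].
by rewrite jacobi_gauss_sign//; case: (gauss_sign_pm1 b a) => ->; [left|right].
Qed.

Lemma dedekindN_mu (b a : nat) : odd a -> coprime b a ->
  (8 %| dedekindN b a - a%:Z + 1 - mu b%:Z a)%Z.
Proof.
move=> oa cba; rewrite /mu oa jacobi_gauss_sign//.
have := dedekindN_mod8 oa cba.
by congr (_ %| _)%Z; ring.
Qed.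

Lemma odd_PoszP (n : nat) : odd n -> exists k : int, n%:Z = 2 * k + 1.
Proof. by move=> on; exists n./2; lia. Qed.

Lemma int_parity (z : int) : (exists k, z = 2 * k) \/ (exists k, z = 2 * k + 1).
Proof.
have [e|e] : (z %% 2 = 0 \/ z %% 2 = 1)%Z by lia.
  by left; exists (z %/ 2)%Z; lia.
by right; exists (z %/ 2)%Z; lia.
Qed.

(* The correction term is the difference between the criterion read off from
   reciprocity and the one of the theorem; both force the shape of [w]. *)
Lemma dvdz8b_correction (x y b w : int) :
  (exists k, x = 2 * k + 1) -> (exists k, y = 2 * k + 1) -> b != 0 ->
  (x - y) * (x * y - 1) = b * w -> (2 %| w)%Z ->
  ((4 %| x - y)%Z -> (4 %| w)%Z) ->
  (8 * b %| (b - 2) * ((x - y) * (x * y - 1)) + 2 * b ^+ 2 * (x - y))%Z.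
Proof.
move=> [k ->] [l ->] b0 eX w2 w4; rewrite eX.
suff /dvdzP[t et] : (8 %| (b - 2) * w + 2 * b * (2 * k + 1 - (2 * l + 1)))%Z.
  apply/dvdzP; exists t; transitivity (b * (t * 8)); last by ring.
  by rewrite -et; ring.
have [[u eu]|[u eu]] := int_parity (k - l).
  have {w4} /dvdzP[w' ew] : (4 %| w)%Z by apply: w4; apply/dvdzP; exists u; lia.
  have ek : k = l + 2 * u by lia.
  rewrite {}ew {}ek {eu w2 k} in eX *.
  have [[b' eb]|[b' eb]] := int_parity b; first by apply/dvdzP; exists ((b' -
    1) * w' + b * u); rewrite eb; ring.
  have [[w'' ew]|[w'' ew]] := int_parity w'; first by apply/dvdzP; exists ((b -
    2) * w'' + b * u); rewrite ew; ring.
  (* Both [x - y] and [x * y - 1] are multiples of 4, so [4 %| b * w'], and [b] and [w'] cannot both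
     be odd. *)
  by exfalso; move: eX; rewrite eb ew; lia.
have ek : k = l + 2 * u + 1 by lia.
case/dvdzP: w2 => w' ew; rewrite {}ew {}ek {eu w4 k} in eX *.
(* Now [x - y = 2 * (2 * u + 1)] and [x * y - 1 = 2 * (2 * v + 1)], so [b * w'] is twice an odd
   number: exactly one of [b] and [w'] is even. *)
set v := (l + 2 * u + 1) * l + l + u.
have {}eX : 2 * ((2 * u + 1) * (2 * v + 1)) = b * w'.
  apply: (mulfI (_ : (2 : int) != 0)) => //; transitivity (b * (w' * 2)); last
    by ring.
  by rewrite -eX /v; ring.
have -> : (b - 2) * (w' * 2) + 2 * b * (2 * (l + 2 * u + 1) + 1 - (2 * l + 1)) =
  2 * (b * w') - 4 * w' + 4 * b * (2 * u + 1) by ring.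
rewrite -eX; move: v eX => v eX.
have [[b' eb]|[b' eb]] := int_parity b;
  have [[w'' ew]|[w'' ew]] := int_parity w'; rewrite eb ew in eX *.
- by exfalso; lia.
- apply/dvdzP; exists (2 * u * v + u + v - w'' + b' * (2 * u + 1)); ring.
- apply/dvdzP; exists (2 * u * v + u + v + 1 - w'' + 2 * b' * u + b' + u); ring.
- by exfalso; lia.
Qed.

(** This is [y] times the reciprocity law for [(x, b)] minus [x] times that for [(y, b)]; the terms
    [3 * x * y * b] cancel. *)
Lemma dedekindN_diff (x y b : nat) : (0 < x)%N -> (0 < y)%N -> (0 < b)%N ->
  coprime x b -> coprime y b ->
  x%:Z * y%:Z * (dedekindN x b - dedekindN y b) =
  (x%:Z - y%:Z) * (x%:Z * y%:Z - 1) - b%:Z ^+ 2 * (x%:Z - y%:Z)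
  - b%:Z * (y%:Z * dedekindN b x - x%:Z * dedekindN b y).
Proof.
move=> x0 y0 b0 cxb cyb.
have := dedekindN_reciprocity x0 b0 cxb; have := dedekindN_reciprocity y0 b0
  cyb.
move: (dedekindN x b) (dedekindN b x) (dedekindN y b) (dedekindN b y) => n n' m
  m' e1 e2.
transitivity (y%:Z * (x%:Z * n + b%:Z * n') - x%:Z * (y%:Z * m + b%:Z * m')
  - b%:Z * (y%:Z * n' - x%:Z * m')); first by ring.
by rewrite e1 e2; ring.
Qed.

Lemma Gauss_dvdzMl (c x y z : int) : coprimez c x -> coprimez c y ->
  (c %| x * y * z)%Z = (c %| z)%Z.
Proof. by move=> cx cy; rewrite -mulrA !Gauss_dvdzr. Qed.

Lemma dvdz_dedekindN_diff (x y b : nat) : (0 < x)%N -> (0 < y)%N -> (0 < b)%N ->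
  coprime x b -> coprime y b ->
  (b%:Z %| dedekindN x b - dedekindN y b)%Z =
  (b%:Z %| (x%:Z - y%:Z) * (x%:Z * y%:Z - 1))%Z.
Proof.
move=> x0 y0 b0 cxb cyb.
rewrite -(@Gauss_dvdzMl b x y) 1?coprimezE 1?coprime_sym// dedekindN_diff//.
by rewrite rpredBr ?rpredBr// ?dvdz_mulr// exprS dvdz_mulr.
Qed.

(** If [b = 3 * c], then 3 does not divide [c], and the goal becomes divisibility by 9 and by [c].
    Modulo 9 [dedekindN_diff] leaves only [(x - y) * (x * y - 1)], because 3 divides [dedekindN b x]
    and [dedekindN b y]. *)
Lemma dedekindN_diff_mod3 (x y b : nat) : (0 < x)%N -> (0 < y)%N -> (0 < b)%N ->
  coprime x b -> coprime y b -> ~~ (9 %| b)%N ->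
  (b%:Z %| dedekindN x b - dedekindN y b)%Z ->
  (3 * b%:Z %| dedekindN x b - dedekindN y b)%Z.
Proof.
move=> x0 y0 b0 cxb cyb b9 bD; have [b3|b3] := boolP (3 %| b)%N; last first.
  have c3b : coprimez 3 b by rewrite coprimezE /= prime_coprime.
  by rewrite Gauss_dvdz// bD andbT rpredB ?dedekindN_mod3.
have nx : ~~ (3 %| x)%N by rewrite -prime_coprime// (coprime_dvdl b3)//
  coprime_sym.
have ny : ~~ (3 %| y)%N by rewrite -prime_coprime// (coprime_dvdl b3)//
  coprime_sym.
have /dvdnP[c ec] := b3; have c3 : ~~ (3 %| c)%N.
  by apply: contra b9; rewrite ec => /dvdnP[e ->]; rewrite -mulnA dvdn_mull.
have c9z (z : nat) : ~~ (3 %| z)%N -> coprimez 9 z.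
  by move=> z3; rewrite coprimezE; change (coprime (3 ^ 2) z); rewrite
    coprimeXl// prime_coprime.
have -> : 3 * b%:Z = 9 * c%:Z by lia.
rewrite Gauss_dvdz ?c9z//; apply/andP; split; last first.
  by apply: dvdz_trans bD; rewrite ec PoszM dvdz_mulr.
rewrite -(@Gauss_dvdzMl 9 x y) ?c9z// dedekindN_diff//.
move: bD; rewrite dvdz_dedekindN_diff//.
have /dvdzP[u ->] := dedekindN_mod3 b nx; have /dvdzP[v ->] := dedekindN_mod3 b
  ny.
rewrite ec PoszM => /dvdzP[t et].
(* As 3 divides neither [x] nor [y], it divides [x - y] iff it divides [x * y - 1]; dividing the
   product, it divides both factors. *)
have X9 : (9 %| (x%:Z - y%:Z) * (x%:Z * y%:Z - 1))%Z.
  have [x' ex] : exists x' : int, x%:Z = 3 * x' + 1 \/ x%:Z = 3 * x' + 2 by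
    exists (x %/ 3)%N; lia.
  have [y' ey] : exists y' : int, y%:Z = 3 * y' + 1 \/ y%:Z = 3 * y' + 2 by
    exists (y %/ 3)%N; lia.
  by move: et; case: ex => ->; case: ey => ->; lia.
case/dvdzP: X9 => s ->; apply/dvdzP.
exists (s - c%:Z ^+ 2 * (x%:Z - y%:Z) - c%:Z * (y%:Z * u - x%:Z * v)); ring.
Qed.

Lemma dedekindN_diff_mod24 (x y b : nat) :
  (0 < x)%N -> (0 < y)%N -> (0 < b)%N ->
  coprime x b -> coprime y b -> ~~ (9 %| b)%N ->
  (24 * b%:Z %| dedekindN x b - dedekindN y b)%Z =
  (8 * b%:Z %| dedekindN x b - dedekindN y b)%Z.
Proof.
move=> x0 y0 b0 cxb cyb b9; apply/idP/idP => [|d8].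
  by apply: dvdz_trans; apply/dvdzP; exists 3; ring.
have := dedekindN_diff_mod3 x0 y0 b0 cxb cyb b9.
case/dvdzP: d8 => u ->; rewrite mulrA dvdz_mull// => /(_ isT).
rewrite dvdz_mul2r; last by lia.
move=> d3; have /dvdzP[v ->] : (3 %| u)%Z by lia.
by apply/dvdzP; exists v; ring.
Qed.

(** With [x = 2 * u] and [b = 2 * w + 1], [(b - 1) * (x * y + b - 1) = 4 * w * (u * y + w)]. For odd
    [y], [w * (u * y + w)] is odd iff [w] is odd and [u] even, that is, iff [mu b x = 4]; for even
    [y] both sides vanish modulo 8. *)
Lemma dvdz8_criterion_even (x y b : nat) : ~~ odd x -> odd b -> coprime b x ->
  coprime b y ->
  (8 %| b%:Z * (y%:Z * mu b%:Z x - x%:Z * mu b%:Z y)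
   - (x%:Z - y%:Z) * (b%:Z - 1) * (x%:Z * y%:Z + b%:Z - 1))%Z.
Proof.
move=> ex ob cbx cby.
have [e e2] : exists e : int, mu b%:Z y = 4 * e.
  by case: (mu_eq0_or4 cby) => ->; [exists 0|exists 1].
rewrite e2 /mu (negPf ex).
have ->: (4 %| x)%N = ~~ odd x./2 by lia.
have ->: (b == 3 %[mod 4])%Z = odd b./2 by lia.
have := odd_double_half x; have := odd_double_half b; have := odd_double_half y.
rewrite (negPf ex) ob; move: (x./2) (b./2) (y./2) (odd y) => u w v py <- <- <-.
have := odd_double_half u; have := odd_double_half w.
move: (u./2) (w./2) (odd u) (odd w) => u' w' pu pw <- <-.
by case: pu; case: pw; case: py => /=; lia.
Qed.

(** Modulo [8 * b], the difference of the [dedekindN] times the unit [x * y] is [- Q - E], where [Q]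
    is the difference of the two sides of the criterion. Each of the two divisibilities makes
    [dvdz8b_correction] applicable to [E]. *)
Lemma dvdz8b_criterion_odd (x y b : nat) : odd x -> odd y -> (0 < b)%N ->
  coprime x b -> coprime y b ->
  (8 * b%:Z %| dedekindN x b - dedekindN y b)%Z =
  (8 * b%:Z %| b%:Z * (y%:Z * mu b%:Z x - x%:Z * mu b%:Z y)
   - (x%:Z - y%:Z) * (b%:Z - 1) * (x%:Z * y%:Z + b%:Z - 1))%Z.
Proof.
move=> ox oy b0 cxb cyb.
have x0 : (0 < x)%N by case: (x) ox. have y0 : (0 < y)%N by case: (y) oy.
have c8 z : odd z -> coprime z b -> coprimez (8 * b%:Z) z%:Z.
  move=> oz cz; rewrite coprimezMl !coprimezE /= [X in _ && X]coprime_sym cz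
    andbT.
  by change (coprime (2 ^ 3) z); rewrite coprimeXl// prime_coprime// dvdn2 oz.
rewrite -(@Gauss_dvdzMl _ x y) ?c8// dedekindN_diff//.
have cbx : coprime b x by rewrite coprime_sym.
have cby : coprime b y by rewrite coprime_sym.
have /dvdzP[s es] := dedekindN_mu ox cbx; have /dvdzP[t et] := dedekindN_mu oy
  cby.
have -> : dedekindN b x = s * 8 + x%:Z - 1 + mu b%:Z x by rewrite -es; ring.
have -> : dedekindN b y = t * 8 + y%:Z - 1 + mu b%:Z y by rewrite -et; ring.
have [m em] : exists m, y%:Z * mu b%:Z x - x%:Z * mu b%:Z y = 4 * m.
  case: (mu_eq0_or4 cbx) => ->; case: (mu_eq0_or4 cby) => ->.
  - by exists 0; ring.
  - by exists (- x%:Z); ring.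
  - by exists y%:Z; ring.
  - by exists (y%:Z - x%:Z); ring.
rewrite em; set X := (x%:Z - y%:Z) * (x%:Z * y%:Z - 1).
set Q := b%:Z * (4 * m) - _.
have -> : X - b%:Z ^+ 2 * (x%:Z - y%:Z) - b%:Z * (y%:Z * (s * 8 + x%:Z - 1 + mu
  b%:Z x) - x%:Z * (t * 8 + y%:Z - 1 + mu b%:Z y))
  = - Q - ((b%:Z - 2) * X + 2 * b%:Z ^+ 2 * (x%:Z - y%:Z)) + 8 * b%:Z * (x%:Z *
    t - y%:Z * s).
  rewrite /Q -em /X; ring.
rewrite rpredDr; last exact: dvdz_mulr.
have [x' ex] := odd_PoszP ox; have [y' ey] := odd_PoszP oy.
set E := (b%:Z - 2) * X + _.
(* The cofactor [c * (x - y) + 4 * d] is even, and a multiple of 4 whenever [x - y] is. *)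
have dvdE (c d : int) : X = b%:Z * (c * (x%:Z - y%:Z) + 4 * d) -> (8 * b%:Z %|
  E)%Z.
  move=> eX; apply: dvdz8b_correction eX _ _; rewrite ?ex ?ey.
  - by exists x'.
  - by exists y'.
  - by lia.
  - by apply/dvdzP; exists (c * (x' - y') + 2 * d); ring.
  - by move=> /dvdzP[z ->]; apply/dvdzP; exists (c * z + d); ring.
apply/idP/idP => dv.
  have dE : (8 * b%:Z %| E)%Z.
    case/dvdzP: dv => r er; apply: (dvdE (b%:Z + 1) (m + 2 * r)).
    transitivity (- Q - E + b%:Z * ((b%:Z + 1) * (x%:Z - y%:Z) + 4 * m)).
      by rewrite /Q /E /X; ring.
    by rewrite er; ring.
  by move: dv; rewrite rpredBr// rpredN.
rewrite rpredBr ?rpredN//.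
case/dvdzP: dv => r er; apply: (dvdE (x%:Z * y%:Z - 1 + b%:Z - 1) (- m + 2 *
  r)).
transitivity (Q + b%:Z * ((x%:Z * y%:Z - 1 + b%:Z - 1) * (x%:Z - y%:Z) - 4 *
  m)).
  by rewrite /Q /X; ring.
by rewrite er; ring.
Qed.

Lemma dvdz8b_criterion_even (x y b : nat) : ~~ odd x ->
  (0 < x)%N -> (0 < y)%N -> (0 < b)%N ->
  coprime x b -> coprime y b ->
  (8 * b%:Z %| dedekindN x b - dedekindN y b)%Z =
  (8 * b%:Z %| b%:Z * (y%:Z * mu b%:Z x - x%:Z * mu b%:Z y)
   - (x%:Z - y%:Z) * (b%:Z - 1) * (x%:Z * y%:Z + b%:Z - 1))%Z.
Proof.
move=> ex x0 y0 b0 cxb cyb.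
have cbx : coprime b x by rewrite coprime_sym.
have cby : coprime b y by rewrite coprime_sym.
have ob : odd b.
  rewrite -[odd b]negbK -dvdn2 -prime_coprime// (coprime_dvdl _ cxb)// dvdn2.
  exact: ex.
have c8b : coprimez 8 b.
  by rewrite coprimezE; change (coprime (2 ^ 3) b); rewrite coprimeXl//
    prime_coprime// dvdn2 ob.
rewrite !Gauss_dvdz// dvdz8_criterion_even//= dvdz_dedekindN_diff//.
set X := (x%:Z - y%:Z) * (x%:Z * y%:Z - 1).
set Q := b%:Z * _ - _.
have -> : (b%:Z %| Q)%Z = (b%:Z %| X)%Z.
  have -> : Q = X + b%:Z * ((y%:Z * mu b%:Z x - x%:Z * mu b%:Z y) - X - (b%:Z -
    1) * (x%:Z - y%:Z)).
    by rewrite /Q /X; ring.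
  by rewrite rpredDr// dvdz_mulr.
(* Only divisibility by 8 on the left remains. When [b] divides [X], the signs agree, so the two
   congruences modulo 8 cancel. *)
have [bX|] := boolP (b%:Z %| X)%Z; last by rewrite andbF.
rewrite andbT; have := jacobi_eq_dvdz ob cxb cyb bX; rewrite
  !jacobi_gauss_sign// => eg.
have d1 := dedekindN_mod8 ob cxb; have d2 := dedekindN_mod8 ob cyb.
by have := rpredB d1 d2; rewrite eg; congr (_ %| _)%Z; ring.
Qed.

Lemma dvdz8b_criterion (x y b : nat) : (0 < x)%N -> (0 < y)%N -> (0 < b)%N ->
  coprime x b -> coprime y b ->
  (8 * b%:Z %| dedekindN x b - dedekindN y b)%Z =
  (8 * b%:Z %| b%:Z * (y%:Z * mu b%:Z x - x%:Z * mu b%:Z y)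
   - (x%:Z - y%:Z) * (b%:Z - 1) * (x%:Z * y%:Z + b%:Z - 1))%Z.
Proof.
move=> x0 y0 b0 cxb cyb.
have [ox|ex] := boolP (odd x); last exact: dvdz8b_criterion_even.
have [oy|ey] := boolP (odd y); first exact: dvdz8b_criterion_odd.
(* Both dividends change sign when [x] and [y] are exchanged. *)
rewrite -[LHS]rpredN -[RHS]rpredN opprB dvdz8b_criterion_even//;
  congr (_ %| _)%Z; ring.
Qed.

Theorem theorem1 (b a1 a2 : nat)
    (hb : (0 < b)%N) (ha1 : (0 < a1)%N) (ha2 : (0 < a2)%N)
    (hcop1 : coprime a1 b) (hcop2 : coprime a2 b)
    (h9 : ~~ (9 %| b)%N) :
  (exists m : int,
      dedekindS a1%:Z b - dedekindS a2%:Z b = 24%:R * m%:~R)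
  <->
  (b%:Z * (a2%:Z * mu b%:Z a1 - a1%:Z * mu b%:Z a2)
   = (a1%:Z - a2%:Z) * (b%:Z - 1) * (a1%:Z * a2%:Z + b%:Z - 1)
     %[mod 8 * b%:Z])%Z.
Proof.
have b0 : (b%:R : rat) != 0 by rewrite pnatr_eq0 -lt0n.
have SN : b%:R * (dedekindS a1%:Z b - dedekindS a2%:Z b) =
    (dedekindN a1 b - dedekindN a2 b)%:~R.
  by rewrite mulrBr !dedekindS_dedekindN// intrB.
(* Multiplied by [b], membership in [24Z] becomes divisibility by [24 * b], which is equivalent to
   divisibility by [8 * b]. *)
transitivity (8 * b%:Z %| dedekindN a1 b - dedekindN a2 b)%Z; last first.
  by rewrite dvdz8b_criterion// -eqz_mod_dvd; split=> /eqP.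
rewrite -dedekindN_diff_mod24//; split=> [[m em]|/dvdzP[m em]].
  apply/dvdzP; exists m; apply: (@intr_inj rat).
  by rewrite -SN em !intrM -!pmulrn; ring.
exists m; apply: (mulfI b0); rewrite SN em !intrM -!pmulrn; ring.
Qed.
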